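(* Let $I\subsetneq E$ be a monomial ideal of $E=K\langle e_1,\dots,e_n\rangle$ with linear quotients (with respect to a degree increasing order of $G(I)$, with respect to which the sets $\mathrm{set}(u)$ are formed). Then $$\beta_{i,i+j}(I)=\sum_{u\in G(I)_j}\binom{i+|\mathrm{set}(u)|-1}{|\mathrm{set}(u)|-1}$$ for all $i\ge 0$ and all $j$. Hence $$\beta_i(I)=\sum_{u\in G(I)}\binom{i+|\mathrm{set}(u)|-1}{|\mathrm{set}(u)|-1}\qquad\text{for all } i\ge0.$$
   Context: $K$ is a field, $E=K\langle e_1,\dots,e_n\rangle$ is the exterior algebra of a $K$-vector space with basis $e_1,\dots,e_n$, standard graded. A monomial is a product $e_\mu=e_{i_1}\cdots e_{i_d}$, $\mu=\{i_1<\dots<i_d\}\subseteq[n]=\{1,\dots,n\}$ (up to sign), with $\mathrm{supp}(e_\mu)=\mu$. A monomial ideal is an ideal generated by monomials; $G(I)$ is its unique minimal set of monomial generators and $G(I)_j$ is the set of elements of $G(I)$ of degree $j$. For a graded $E$-module $M$, $\beta_{i,j}(M)=\dim_K\mathrm{Tor}_i^E(M,K)_j$ and $\beta_i(M)=\sum_j\beta_{i,j}(M)$. For an ideal $J$ and a monomial $u$, $J:(u)=\{x\in E:xu\in J\}$. $I$ has linear quotients with respect to an order $u_1,\dots,u_r$ of $G(I)$ if $0:(u_1)$ and $(u_1,\dots,u_{j-1}):(u_j)$, $j=2,\dots,r$, are each generated by a subset of $\{e_1,\dots,e_n\}$. The order is degree increasing if $\deg u_1\le\dots\le\deg u_r$.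 One sets $\mathrm{set}(u_j)=\{k\in[n]:e_k\in(u_1,\dots,u_{j-1}):(u_j)\}$ for $j\ge2$ and $\mathrm{set}(u_1)=\{k\in[n]:e_k\in0:(u_1)\}=\mathrm{supp}(u_1)$. *)

(* Defs.v *)
From HB Require Import structures.
From mathcomp Require Import all_boot all_order all_algebra all_field.

Set Implicit Arguments.
Unset Strict Implicit.
Unset Printing Implicit Defensive.

Import Order.TTheory GRing.Theory Num.Theory.
Local Open Scope ring_scope.

(* The exterior algebra K<e_1, ..., e_n>, given by coordinates on the basis
   e_A, A a subset of the index set 'I_n (so indices start at 0). *)
Definition exterior (K : fieldType) (n : nat) := {ffun {set 'I_n} -> K^o}.

HB.instance Definition _ (K : fieldType) (n : nat) :=
  Vector.copy (exterior K n) {ffun {set 'I_n} -> K^o}.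

Section ExteriorAlgebra.

Variables (K : fieldType) (n : nat).
Local Notation E := (exterior K n).
Implicit Types (A B C : {set 'I_n}) (x y z : E).

(* e_A, the product of the e_i, i in A, taken in increasing order:
   see mon_prod. *)
Definition mon A : E := [ffun B => (B == A)%:R].

Definition inversions A B : nat :=
  (\sum_(i in A) \sum_(j in B) (j < i : nat))%N.

Definition mon_mul A B : E :=
  if [disjoint A & B] then (-1) ^+ inversions A B *: mon (A :|: B) else 0.

Definition ext_mul x y : E := \sum_A \sum_B (x A * y B) *: mon_mul A B.

Lemma ext_sumE (I : Type) (r : seq I) (P : pred I) (F : I -> E) A :
  (\sum_(i <- r | P i) F i) A = \sum_(i <- r | P i) F i A.
Proof.
by elim/big_rec2: _ => [|i u v _ <-]; rewrite ?ffunE.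
Qed.

Lemma ext_coord x : x = \sum_A x A *: mon A.
Proof.
apply/ffunP=> B; rewrite ext_sumE (bigD1 B) //= big1 ?addr0 => [|A /negPf nAB].
  by rewrite !ffunE eqxx /GRing.scale /= mulr1.
by rewrite !ffunE eq_sym nAB /GRing.scale /= mulr0.
Qed.

Fact ext_mulDl : left_distributive ext_mul +%R.
Proof.
move=> x y z; rewrite /ext_mul -big_split; apply: eq_bigr => A _ /=.
rewrite -big_split; apply: eq_bigr => B _ /=.
by rewrite !ffunE mulrDl scalerDl.
Qed.

Fact ext_mulDr : right_distributive ext_mul +%R.
Proof.
move=> x y z; rewrite /ext_mul -big_split; apply: eq_bigr => A _ /=.
rewrite -big_split; apply: eq_bigr => B _ /=.
by rewrite !ffunE mulrDr scalerDl.
Qed.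

Fact ext_scaleAl a x y : a *: ext_mul x y = ext_mul (a *: x) y.
Proof.
rewrite /ext_mul scaler_sumr; apply: eq_bigr => A _.
rewrite scaler_sumr; apply: eq_bigr => B _.
by rewrite scalerA ffunE /GRing.scale /= mulrA.
Qed.

Fact ext_scaleAr a x y : a *: ext_mul x y = ext_mul x (a *: y).
Proof.
rewrite /ext_mul scaler_sumr; apply: eq_bigr => A _.
rewrite scaler_sumr; apply: eq_bigr => B _.
by rewrite scalerA ffunE /GRing.scale /= mulrCA.
Qed.

Lemma ext_mul0 x : ext_mul x 0 = 0.
Proof. by have := ext_scaleAr 0 x 0; rewrite !scale0r => <-. Qed.

Lemma ext_0mul x : ext_mul 0 x = 0.
Proof. by have := ext_scaleAl 0 0 x; rewrite !scale0r => <-. Qed.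

Lemma ext_mul_suml (I : Type) (r : seq I) (P : pred I) (F : I -> E) y :
  ext_mul (\sum_(i <- r | P i) F i) y = \sum_(i <- r | P i) ext_mul (F i) y.
Proof.
by elim/big_rec2: _ => [|i u v _ <-]; rewrite ?ext_0mul ?ext_mulDl.
Qed.

Lemma ext_mul_sumr (I : Type) (r : seq I) (P : pred I) (F : I -> E) y :
  ext_mul y (\sum_(i <- r | P i) F i) = \sum_(i <- r | P i) ext_mul y (F i).
Proof.
by elim/big_rec2: _ => [|i u v _ <-]; rewrite ?ext_mul0 ?ext_mulDr.
Qed.

Lemma ext_mul_mon A B : ext_mul (mon A) (mon B) = mon_mul A B.
Proof.
rewrite /ext_mul (bigD1 A) //= [X in _ + X]big1 => [|A' /negPf nA]; last first.
  by apply: big1 => B' _; rewrite !ffunE nA mul0r scale0r.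
rewrite addr0 (bigD1 B) //= big1 => [|B' /negPf nB].
  by rewrite !ffunE !eqxx mulr1 scale1r addr0.
by rewrite !ffunE nB mulr0 scale0r.
Qed.

Lemma inversionsUl A B C : [disjoint A & B] ->
  inversions (A :|: B) C = (inversions A C + inversions B C)%N.
Proof.
move=> dAB; rewrite /inversions -bigU //.
by apply: eq_bigl => i; rewrite !inE.
Qed.

Lemma inversionsUr A B C : [disjoint B & C] ->
  inversions A (B :|: C) = (inversions A B + inversions A C)%N.
Proof.
move=> dBC; rewrite /inversions -big_split.
apply: eq_bigr => i _; rewrite -bigU //.
by apply: eq_bigl => j; rewrite !inE.
Qed.

Lemma mon_mulA A B C :
  ext_mul (mon A) (ext_mul (mon B) (mon C)) =
  ext_mul (ext_mul (mon A) (mon B)) (mon C).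
Proof.
rewrite !ext_mul_mon /mon_mul.
have dU (X Y Z : {set 'I_n}) :
  [disjoint X :|: Y & Z] = [disjoint X & Z] && [disjoint Y & Z].
  by rewrite -!setI_eq0 setIUl setU_eq0.
case: (boolP [disjoint A & B]) => dAB; last first.
  rewrite ext_0mul; case: ifP => [dBC|_]; last by rewrite ext_mul0.
  rewrite -ext_scaleAr ext_mul_mon /mon_mul disjoint_sym dU.
  by rewrite disjoint_sym (negPf dAB) scaler0.
rewrite -ext_scaleAl ext_mul_mon /mon_mul dU.
case: (boolP [disjoint B & C]) => dBC; last first.
  by rewrite andbF ext_mul0 scaler0.
rewrite -ext_scaleAr ext_mul_mon /mon_mul disjoint_sym dU.
rewrite ![[disjoint _ & A]]disjoint_sym dAB andbT /=.
case: (boolP [disjoint A & C]) => dAC; last by rewrite !scaler0.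
rewrite !scalerA -!exprD setUA inversionsUl // inversionsUr //.
by congr (_ ^+ _ *: _); rewrite addnC -!addnA; congr addn; rewrite addnC.
Qed.

Fact ext_mulA : associative ext_mul.
Proof.
move=> x y z; rewrite [x]ext_coord (ext_mul_suml _ _ _ (ext_mul y z)).
rewrite (ext_mul_suml _ _ _ y) (ext_mul_suml _ _ _ z); apply: eq_bigr => A _.
rewrite -!ext_scaleAl; congr (_ *: _).
rewrite [y]ext_coord (ext_mul_suml _ _ _ z) !(ext_mul_sumr _ _ _ (mon A)).
rewrite (ext_mul_suml _ _ _ z); apply: eq_bigr => B _.
rewrite -ext_scaleAl -!ext_scaleAr -ext_scaleAl; congr (_ *: _).
rewrite [z]ext_coord (ext_mul_sumr _ _ _ (mon B)).
rewrite (ext_mul_sumr _ _ _ (mon A)) (ext_mul_sumr _ _ _ (ext_mul _ _)).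
by apply: eq_bigr => C _; rewrite -!ext_scaleAr mon_mulA.
Qed.

Lemma inversions0l A : inversions set0 A = 0%N.
Proof. by rewrite /inversions big_set0. Qed.

Lemma inversions0r A : inversions A set0 = 0%N.
Proof. by rewrite /inversions big1 // => i _; rewrite big_set0. Qed.

Fact ext_mul1l : left_id (mon set0) ext_mul.
Proof.
move=> x; rewrite {1}(ext_coord x) ext_mul_sumr [RHS]ext_coord.
apply: eq_bigr => A _; rewrite -ext_scaleAr ext_mul_mon /mon_mul.
by rewrite -setI_eq0 set0I eqxx inversions0l scale1r set0U.
Qed.

Fact ext_mul1r : right_id (mon set0) ext_mul.
Proof.
move=> x; rewrite {1}(ext_coord x) ext_mul_suml [RHS]ext_coord.
apply: eq_bigr => A _; rewrite -ext_scaleAl ext_mul_mon /mon_mul.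
by rewrite -setI_eq0 setI0 eqxx inversions0r scale1r setU0.
Qed.

Fact ext_1neq0 : mon set0 != 0.
Proof.
by apply/eqP=> /ffunP/(_ set0)/eqP; rewrite !ffunE eqxx oner_eq0.
Qed.

HB.instance Definition _ := GRing.Zmodule_isNzRing.Build E
  ext_mulA ext_mul1l ext_mul1r ext_mulDl ext_mulDr ext_1neq0.
HB.instance Definition _ := GRing.Lmodule_isLalgebra.Build K E ext_scaleAl.
HB.instance Definition _ := GRing.Lalgebra_isAlgebra.Build K E ext_scaleAr.
HB.instance Definition _ := Algebra_isFalgebra.Build K E.

Definition ext_gen (k : 'I_n) : E := mon [set k].

Lemma ext_gen_sqr k : ext_gen k * ext_gen k = 0.
Proof.
rewrite [LHS]ext_mul_mon /mon_mul -setI_eq0 setIid.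
by rewrite -cards_eq0 cards1.
Qed.

Lemma ext_gen_anticomm k l : ext_gen k * ext_gen l = - (ext_gen l * ext_gen k).
Proof.
have [->|neq_kl] := eqVneq k l; first by rewrite ext_gen_sqr oppr0.
rewrite ![_ * _]ext_mul_mon /mon_mul ![[disjoint [set _] & _]]disjoints1 !inE.
rewrite [l == k]eq_sym neq_kl /inversions !big_set1 setUC.
case: (ltngtP k l) => [||/val_inj/eqP]; last by rewrite (negPf neq_kl).
  by rewrite expr1 expr0 scaleN1r scale1r opprK.
by rewrite expr1 expr0 scaleN1r scale1r.
Qed.

Lemma mon_prod A : mon A = \prod_(i <- enum A) ext_gen i.
Proof.
have: sorted ltn (map val (enum A)).
  rewrite {1}/enum_mem -enumT; apply: (@subseq_sorted _ ltn ltn_trans _ (iota 0 n)).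
    by rewrite -[iota 0 n]val_enum_ord; apply/map_subseq/filter_subseq.
  exact: iota_ltn_sorted.
have: A = [set i in enum A] by apply/setP=> i; rewrite inE mem_enum.
move: (enum A) => s; elim: s A => [|i s IHs] A -> /=.
  by move=> _; rewrite big_nil; congr mon; apply/setP=> i; rewrite !inE.
rewrite (path_sortedE ltn_trans) big_cons => /andP[/allP lt_i sorted_s].
rewrite -(IHs [set j in s]) // [RHS]ext_mul_mon /mon_mul.
have i_s: i \notin s.
  by apply/negP=> /(map_f val)/lt_i; rewrite /= ltnn.
rewrite disjoints1 inE i_s /inversions big_set1 big1 ?scale1r => [|j].
  by congr mon; apply/setP=> j; rewrite !inE.
rewrite inE => /(map_f val)/lt_i /= lt_ij.
by rewrite ltnNge (ltnW lt_ij).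
Qed.

(* The graded component of degree d; it is 0 unless 0 <= d <= n. *)
Definition homog (d : int) : {vspace E} :=
  <<[seq mon A | A <- enum {set 'I_n} & #|A|%:Z == d]>>%VS.

Definition ideal_gen (X : seq E) : {vspace E} := ({:E} * <<X>> * {:E})%VS.

Definition mon_ideal (s : seq {set 'I_n}) : {vspace E} :=
  ideal_gen [seq mon A | A <- s].

Definition is_monomial_ideal (I : {vspace E}) : bool :=
  [exists S : {set {set 'I_n}}, I == mon_ideal (enum S)].

(* G(I); the default value is only reached when I is not a monomial ideal,
   and the minimal set picked is unique when it is one. *)
Definition mingens (I : {vspace E}) : {set {set 'I_n}} :=
  odflt set0
    [pick G | minset [pred S : {set {set 'I_n}} | mon_ideal (enum S) == I] G].

(* J : (u) = {x | x * u \in J} *)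
Definition colon (J : {vspace E}) (u : E) : {vspace E} :=
  (amulr u @^-1: J)%VS.

(* (u_1, ..., u_(j-1)) : (u_j) for u = u_j in s; it is 0 : (u_1) for j = 1. *)
Definition prev_colon (s : seq {set 'I_n}) (u : {set 'I_n}) : {vspace E} :=
  colon (mon_ideal (take (index u s) s)) (mon u).

Definition linear_quotients (I : {vspace E}) (s : seq {set 'I_n}) : bool :=
  perm_eq s (enum (mingens I)) &&
  all (fun u => [exists T : {set 'I_n},
                   prev_colon s u == ideal_gen [seq ext_gen k | k <- enum T]]) s.

Definition degree_increasing (s : seq {set 'I_n}) : bool :=
  sorted leq [seq #|u| | u : {set 'I_n} <- s].

Definition lqset (s : seq {set 'I_n}) (u : {set 'I_n}) : {set 'I_n} :=
  [set k | ext_gen k \in prev_colon s u].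

(* A complex ... -> F_1 -> F_0 -> E of graded free left E-modules: F_i has
   basis elements of degrees gdeg i a, a < rk i, its elements are row vectors,
   and the maps are right multiplications by matrices. *)
Record free_complex := FreeComplex {
  rk : nat -> nat;
  gdeg : forall i, 'I_(rk i) -> int;
  aug : 'cV[E]_(rk 0);
  diff : forall i, 'M[E]_(rk i.+1, rk i)
}.

Definition is_graded_complex (F : free_complex) : Prop :=
  (forall a, aug F a 0 \in homog (gdeg a)) /\
  (forall i a b, diff F i a b \in homog (gdeg a - gdeg b)).

Definition is_exact (m1 m2 m3 : nat) (D1 : 'M[E]_(m1, m2)) (D2 : 'M[E]_(m2, m3)) :=
  forall v : 'rV[E]_m2, v *m D2 = 0 <-> exists w : 'rV[E]_m1, v = w *m D1.

Definition is_graded_free_resolution (I : {vspace E}) (F : free_complex) : Prop :=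
  [/\ is_graded_complex F,
      forall x : E, x \in I <-> exists w : 'rV[E]_(rk F 0), x%:M = w *m aug F,
      is_exact (diff F 0) (aug F)
    & forall i, is_exact (diff F i.+1) (diff F i)].

(* The complex K (x)_E F: K is E modulo the ideal (e_1, ..., e_n), and the
   class of x : E in K is its coordinate on mon set0 = 1. *)
Definition tdiff (F : free_complex) (i : nat) : 'M[K]_(rk F i.+1, rk F i) :=
  map_mx (fun x : E => x set0) (diff F i).

Definition tcycles (F : free_complex) (i : nat) : 'M[K]_(rk F i) :=
  match i with
  | 0 => 1%:M
  | i'.+1 => kermx (tdiff F i')
  end.

Definition tcomp (F : free_complex) (i : nat) (j : int) : 'M[K]_(rk F i) :=
  diag_mx (\row_a (gdeg a == j)%:R).

(* dim_K H_i(K (x)_E F)_j *)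
Definition tor_dim (F : free_complex) (i : nat) (j : int) : nat :=
  (\rank (tcycles F i :&: tcomp F i j) - \rank (tdiff F i :&: tcomp F i j))%N.

(* (K (x)_E F_i)_j = 0 unless j is the degree of a basis element of F_i, so
   this is the sum over all degrees j. *)
Definition tor_total_dim (F : free_complex) (i : nat) : nat :=
  (\sum_(j <- undup (codom (@gdeg F i))) tor_dim F i j)%N.

(* beta_(i,j)(I) = b and beta_i(I) = b, where Tor^E(I, K) is computed by any
   graded free resolution of I. *)
Definition graded_betti (I : {vspace E}) (i : nat) (j : int) (b : nat) : Prop :=
  (exists F, is_graded_free_resolution I F) /\
  (forall F, is_graded_free_resolution I F -> tor_dim F i j = b).

Definition total_betti (I : {vspace E}) (i : nat) (b : nat) : Prop :=
  (exists F, is_graded_free_resolution I F) /\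
  (forall F, is_graded_free_resolution I F -> tor_total_dim F i = b).

End ExteriorAlgebra.

(* Main.v *)
From HB Require Import structures.
Require Import Defs.
From mathcomp Require Import all_boot all_order all_algebra all_field.
From mathcomp Require Import zify.
From Stdlib Require Import ClassicalEpsilon.
Import Order.TTheory GRing.Theory Num.Theory.
Local Open Scope ring_scope.

Set Implicit Arguments.
Unset Strict Implicit.
Unset Printing Implicit Defensive.

(** Let u_1, ..., u_r be the given order, I_j = (u_1, ..., u_j) and T_j = set(u_j),
so that I_j / I_(j-1) is E/(e_k : k in T_j) shifted by deg u_j. The quotient
E/(e_k : k in T) is resolved by the Cartan complex, which is linear, with one basis
element of homological degree i for each monomial of degree i in #|T| variables.
Lifting multiplication by u_j to a chain map from the Cartan complex of T_j to the
resolution of I_(j-1) gives, as mapping cone, a resolution of I_j. Since the degrees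
of the u_j increase, the lifted map has entries of positive degree, so the cone is
again minimal. Any other resolution is homotopy equivalent to this one, and for a
minimal resolution Tor is read off from the degrees of the basis elements. *)

(** * Supports, degrees and monomial ideals *)

Section ExteriorSupport.

Variables (K : fieldType) (n : nat).
Local Notation E := (exterior K n).
Implicit Types (A B C : {set 'I_n}) (x y z : E).

Definition supported (P : pred {set 'I_n}) x := forall A, x A != 0 -> P A.

Lemma mem_span_mon (s : seq {set 'I_n}) x :
  x \in <<[seq mon K A | A <- s]>>%VS <-> supported [in s] x.
Proof.
split=> [|sx]; last first.
  rewrite [x]ext_coord; apply: memv_suml => A _.
  have [->|/sx sA] := eqVneq (x A) 0; first by rewrite scale0r mem0v.
  by apply/memvZ/memv_span/map_f.
move=> xs A xA; apply: contraR xA => sA.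
(* The coordinate at [A] is a linear form vanishing on all the generators, hence on their span. *)
pose f : E -> K^o := fun y => y A.
have fl : linear f by move=> a u v; rewrite /f !ffunE.
pose L := GRing.isLinear.Build K E K^o *:%R f fl.
pose g : {linear E -> K^o} := HB.pack f L.
have : (<<[seq mon K A | A <- s]>> <= lker (linfun g))%VS.
  apply/span_subvP => _ /mapP[B sB ->].
  rewrite memv_ker lfunE /= /f ffunE; case: (A =P B) => [AB|//].
  by rewrite AB sB in sA.
by move/subvP=> /(_ x xs); rewrite memv_ker lfunE.
Qed.

Lemma mulE x y A : (x * y) A = \sum_B \sum_C x B * y C * mon_mul K B C A.
Proof.
rewrite [x * y]/(ext_mul x y) /ext_mul ext_sumE; apply: eq_bigr => B _.
by rewrite ext_sumE; apply: eq_bigr => C _; rewrite ffunE.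
Qed.

Lemma mon_mulE A B C : mon_mul K A B C =
  if [disjoint A & B] && (C == A :|: B) then (-1) ^+ inversions A B else 0.
Proof.
rewrite /mon_mul; case: ifP => _ /=; last by rewrite ffunE.
by rewrite !ffunE /GRing.scale /=; case: eqP; rewrite ?mulr1 ?mulr0.
Qed.

(** Only [B :\: A] is disjoint from [A] with union [B], so one term of the product survives. *)
Lemma mulr_monE x A B : (x * mon K A) B =
  if A \subset B then (-1) ^+ inversions (B :\: A) A * x (B :\: A) else 0.
Proof.
rewrite mulE.
transitivity (\sum_C x C * mon_mul K C A B).
  apply: eq_bigr => C _; rewrite (bigD1 A) //= big1 ?addr0 => [|D nD].
    by rewrite ffunE eqxx mulr1.
  by rewrite ffunE (negPf nD) mulr0 mul0r.
have [sAB|nsAB] := ifPn; last first.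
  apply: big1 => C _; rewrite mon_mulE; case: ifP => [|_]; last exact: mulr0.
  by case/andP=> _ /eqP eB; rewrite eB subsetUr in nsAB.
rewrite (bigD1 (B :\: A)) //= big1 ?addr0 => [|C nC].
  rewrite mon_mulE -setI_eq0 setIDAC setDIl setDv setI0 eqxx /= setUC.
  by rewrite -{2}(setIidPr sAB) setID eqxx mulrC.
rewrite mon_mulE; case: ifP => [|_]; last by rewrite mulr0.
case/andP=> dCA /eqP eB; case/eqP: nC.
by rewrite eB setDUl setDv setU0; apply/esym/setDidPl.
Qed.

(** The projection of [E] onto [K], the same map as in [tdiff]. Its ring morphism structure makes
    reduction of matrices compatible with products. *)
Definition counit x : K := x set0.

Fact counit_is_zmod_morphism : zmod_morphism counit.
Proof. by move=> x y; rewrite /counit !ffunE. Qed.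

Fact counit_is_monoid_morphism : monoid_morphism counit.
Proof.
split=> [|x y]; first by rewrite /counit ffunE eqxx.
rewrite {1}/counit mulE (bigD1 set0) //= [X in _ + X]big1 ?addr0 => [|B nB].
  rewrite (bigD1 set0) //= big1 ?addr0 => [|B nB].
    by rewrite mon_mulE -setI_eq0 setI0 setU0 !eqxx inversions0l mulr1.
  by rewrite mon_mulE set0U [set0 == _]eq_sym (negPf nB) andbF mulr0.
apply: big1 => C _; rewrite mon_mulE [set0 == _]eq_sym setU_eq0 (negPf nB).
by rewrite andbF mulr0.
Qed.

HB.instance Definition _ :=
  GRing.isZmodMorphism.Build E K counit counit_is_zmod_morphism.
HB.instance Definition _ :=
  GRing.isMonoidMorphism.Build E K counit counit_is_monoid_morphism.

Lemma homogP (d : int) x :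
  x \in homog K n d <-> forall A, x A != 0 -> #|A|%:Z = d.
Proof.
rewrite /homog; split=> [/mem_span_mon sx A /sx|sx].
  by rewrite mem_filter => /andP[/eqP].
by apply/mem_span_mon=> A /sx dA; rewrite mem_filter dA eqxx mem_enum.
Qed.

Lemma homog_mon A : mon K A \in homog K n #|A|%:Z.
Proof. by apply/homogP => B; rewrite ffunE; case: (B =P A) => [->|]; rewrite ?eqxx. Qed.

Lemma homog_counit (d : int) x : x \in homog K n d -> d != 0 -> counit x = 0.
Proof.
move/homogP=> hx; apply: contraNeq => /hx <-.
by rewrite cards0.
Qed.

Lemma homogM (d e : int) x y :
  x \in homog K n d -> y \in homog K n e -> x * y \in homog K n (d + e).
Proof.
move=> /homogP hx /homogP hy; apply/homogP => A; rewrite mulE => xyA.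
apply/eqP; apply: contraR xyA => nA.
apply/eqP/big1 => B _; apply: big1 => C _; rewrite mon_mulE.
have [->|/hx dB] := eqVneq (x B) 0; first by rewrite !mul0r.
have [->|/hy dC] := eqVneq (y C) 0; first by rewrite mulr0 mul0r.
case: ifP => [/andP[dBC /eqP eA]|_]; last exact: mulr0.
case/eqP: nA; rewrite eA -dB -dC cardsU.
by move: dBC; rewrite -setI_eq0 => /eqP->; rewrite cards0 subn0 PoszD.
Qed.

Definition hproj (d : int) x : E :=
  [ffun A : {set 'I_n} => if #|A|%:Z == d then x A else 0].

Lemma hproj_homog d x : hproj d x \in homog K n d.
Proof.
by apply/homogP => A; rewrite ffunE; case: (_ =P d) => //; rewrite eqxx.
Qed.

Lemma hproj_id d x : x \in homog K n d -> hproj d x = x.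
Proof.
move/homogP=> hx; apply/ffunP=> A; rewrite ffunE; case: (_ =P d) => // nd.
by apply/esym/eqP/contraT => /hx.
Qed.

Lemma hproj_sum d (J : finType) (F : J -> E) :
  hproj d (\sum_j F j) = \sum_j hproj d (F j).
Proof.
apply/ffunP=> A; rewrite ffunE !ext_sumE; case: ifP => dA.
  by apply: eq_bigr => j _; rewrite ffunE dA.
by rewrite big1 // => j _; rewrite ffunE dA.
Qed.

(** Multiplication by [y] raises every degree by exactly [e], so only the part of [x] of degree [d]
    reaches degree [d + e]. *)
Lemma hprojM d e x y : y \in homog K n e -> hproj (d + e) (x * y) = hproj d x * y.
Proof.
move/homogP=> hy; apply/ffunP=> A; rewrite ffunE !mulE.
have key B C : hproj d x B * y C * mon_mul K B C A =
    if #|A|%:Z == d + e then x B * y C * mon_mul K B C A else 0.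
  rewrite ffunE mon_mulE.
  have [->|/hy <-] := eqVneq (y C) 0; first by rewrite !mulr0 !mul0r if_same.
  case: (boolP (_ && (A == B :|: C))) => [/andP[dBC /eqP eA]|_]; last first.
    by rewrite !mulr0 if_same.
  have -> : #|A| = (#|B| + #|C|)%N.
    rewrite eA cardsU; move: dBC; rewrite -setI_eq0 => /eqP->.
    by rewrite cards0 subn0.
  by rewrite PoszD (inj_eq (addIr _)); case: ifP; rewrite ?mul0r.
case: ifP => dA.
  by apply: eq_bigr => B _; apply: eq_bigr => C _; rewrite key dA.
by rewrite big1 // => B _; rewrite big1 // => C _; rewrite key dA.
Qed.

Lemma mem_mul_mon A x :
  (exists y, x = y * mon K A) <-> supported [pred B : {set 'I_n} | A \subset B] x.
Proof.
split=> [[y ->] B|sx].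
  by rewrite mulr_monE /=; case: ifP; rewrite ?eqxx.
(* Division by [mon K A], coordinate by coordinate; the sign squares to 1. Values at sets meeting
   [A] do not affect the product. *)
exists ([ffun B : {set 'I_n} => (-1) ^+ inversions B A * x (B :|: A)] : E).
apply/ffunP=> B; rewrite mulr_monE ffunE; case: ifP => sAB; last first.
  by apply/eqP/contraT => /sx; rewrite /= sAB.
rewrite mulrA -exprMn mulrNN mulr1 expr1n mul1r setUC.
by rewrite -{1}(setIidPr sAB) setID.
Qed.

Lemma mem_mon_ideal (s : seq {set 'I_n}) x :
  x \in mon_ideal K s <-> supported [pred A : {set 'I_n} | has (fun u : {set 'I_n} => u \subset A) s] x.
Proof.
split=> [xs|sx].
  pose P := [pred A : {set 'I_n} | has (fun u : {set 'I_n} => u \subset A) s].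
  (* [W] contains the generators and is stable under multiplication on both sides, since products
     only enlarge supports. *)
  pose W := <<[seq mon K A | A <- enum P]>>%VS.
  have WP y : y \in W <-> supported P y.
    split=> [/mem_span_mon sy A /sy|sy]; first by rewrite mem_enum.
    by apply/mem_span_mon=> A /sy sA; rewrite mem_enum.
  apply/WP; move: x xs; apply/subvP.
  rewrite /mon_ideal /ideal_gen; apply/prodvP => v w vs _.
  have {vs} : v \in W.
    move: v vs; apply/subvP/prodvP => v u _ us.
    have /mem_span_mon su := us; apply/WP => A; rewrite mulE => vuA.
    apply: contraR vuA => /hasPn nA; apply/eqP/big1 => B _; apply: big1 => C _.
    rewrite mon_mulE; have [->|/su sC] := eqVneq (u C) 0; first by rewrite mulr0 mul0r.
    case: ifP => [/andP[_ /eqP eA]|_]; last exact: mulr0.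
    by move: (nA C sC); rewrite eA subsetUr.
  move/WP=> sv; apply/WP => A; rewrite mulE => vwA.
  apply: contraR vwA => /hasPn nA; apply/eqP/big1 => B _; apply: big1 => C _.
  rewrite mon_mulE; have [->|/sv /hasP[u us uB]] := eqVneq (v B) 0; first by rewrite !mul0r.
  case: ifP => [/andP[_ /eqP eA]|_]; last exact: mulr0.
  by move: (nA u us); rewrite eA (subset_trans uB) ?subsetUl.
rewrite [x]ext_coord; apply: memv_suml => A _.
have [->|/sx /hasP[u us uA]] := eqVneq (x A) 0; first by rewrite scale0r mem0v.
apply: memvZ; have [|y ->] := (mem_mul_mon u (mon K A)).2.
  by move=> B; rewrite ffunE /=; case: (B =P A) => [->|]; rewrite ?eqxx.
rewrite -[y * _]mulr1; apply: memv_mul (memvf _).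
by apply: memv_mul (memvf _) _; apply/memv_span/map_f.
Qed.

Lemma mon_ideal_eq_mem (s t : seq {set 'I_n}) :
  s =i t -> mon_ideal K s = mon_ideal K t.
Proof.
move=> st; apply/vspaceP => x; apply/idP/idP => /mem_mon_ideal sx.
  by apply/mem_mon_ideal => A /sx /=; rewrite (eq_has_r st).
by apply/mem_mon_ideal => A /sx /=; rewrite (eq_has_r st).
Qed.

(** Although the ideal is two-sided, one left multiple of [mon K u] suffices: it collects all terms
    of [x] whose support contains [u], and every other term is already divisible by an element of
    [s]. *)
Lemma mem_mon_ideal_rcons (s : seq {set 'I_n}) u x :
  x \in mon_ideal K (rcons s u) <->
  exists y z, y \in mon_ideal K s /\ x = y + z * mon K u.
Proof.
split=> [/mem_mon_ideal sx|[y [z [/mem_mon_ideal sy ->]]]].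
  pose x1 : E := [ffun A : {set 'I_n} => if u \subset A then x A else 0].
  have [|z ez] := (mem_mul_mon u x1).2.
    by move=> A; rewrite ffunE /=; case: ifP; rewrite ?eqxx.
  exists (x - x1), z; rewrite -ez subrK; split=> //.
  apply/mem_mon_ideal => A; rewrite !ffunE /=; case: ifP => [_|nuA].
    by rewrite subrr eqxx.
  by rewrite subr0 => /sx /=; rewrite has_rcons nuA.
apply/mem_mon_ideal => A; rewrite !ffunE mulr_monE /= has_rcons.
by case: ifP => //= _; rewrite addr0 => /sy.
Qed.

Lemma mem_colon (I : {vspace E}) x y : (x \in colon I y) = (x * y \in I).
Proof. by rewrite /colon -memv_preim lfunE. Qed.

Lemma mem_var_ideal (T : {set 'I_n}) x :
  x \in ideal_gen [seq ext_gen K k | k <- enum T] <->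
  supported [pred A : {set 'I_n} | T :&: A != set0] x.
Proof.
rewrite [[seq _ | k <- _]](map_comp (@mon K n) (fun k => [set k])).
rewrite [ideal_gen _]/(mon_ideal K _).
have e A : has (fun u : {set 'I_n} => u \subset A) [seq [set k] | k <- enum T] = (T :&: A != set0).
  rewrite has_map; apply/hasP/set0Pn => [[k]|[k]]; rewrite ?mem_enum /= ?inE.
    by rewrite sub1set => kT kA; exists k; rewrite inE kT.
  by case/andP=> kT kA; exists k; rewrite ?mem_enum //= sub1set.
split=> [/mem_mon_ideal sx A /sx|sx]; first by rewrite /= e.
by apply/mem_mon_ideal => A /sx /=; rewrite e.
Qed.

Lemma ext_gen_var_ideal (T : {set 'I_n}) k :
  (ext_gen K k \in ideal_gen [seq ext_gen K l | l <- enum T]) = (k \in T).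
Proof.
apply/idP/idP => [/mem_var_ideal/(_ [set k])|kT].
  rewrite ffunE eqxx oner_eq0 => /(_ isT) /=.
  by case/set0Pn=> l; rewrite !inE => /andP[lT /eqP <-].
apply/mem_var_ideal => A; rewrite ffunE; case: (A =P _) => [->|]; rewrite ?eqxx // => _.
by apply/set0Pn; exists k; rewrite !inE kT eqxx.
Qed.

(** Modulo the variables of [T], the annihilator of [ext_gen K k] is generated by [ext_gen K k]
    itself. This is what makes the Cartan complex exact. *)
Lemma var_ideal_colon (T : {set 'I_n}) k x : k \notin T ->
  (x * ext_gen K k \in ideal_gen [seq ext_gen K l | l <- enum T]) =
  (x \in ideal_gen [seq ext_gen K l | l <- enum (k |: T)]).
Proof.
move=> kT; apply/idP/idP => /mem_var_ideal sx; apply/mem_var_ideal => A xA /=.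
  case: (boolP (k \in A)) => kA.
    by apply/set0Pn; exists k; rewrite !inE eqxx kA.
  have := sx (k |: A); rewrite mulr_monE sub1set setU11 setU1K // mulf_neq0 //=.
    case/(_ isT)/set0Pn=> l; rewrite !inE => /andP[lT /orP[/eqP lk|lA]].
      by rewrite lk (negPf kT) in lT.
    by apply/set0Pn; exists l; rewrite !inE lT lA orbT.
  by rewrite signr_eq0.
move: xA; rewrite mulr_monE sub1set; case: ifP; rewrite ?eqxx // => kA.
rewrite mulf_eq0 signr_eq0 /= => /sx /set0Pn[l]; rewrite !inE.
case/andP=> + /andP[nlk lA]; rewrite (negPf nlk) /= => lT.
by apply/set0Pn; exists l; rewrite inE lT.
Qed.

Lemma ext_gen_homog_anticomm k x : x \in homog K n 1 ->
  ext_gen K k * x + x * ext_gen K k = 0.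
Proof.
move=> /homogP hx; rewrite [x]ext_coord mulr_sumr mulr_suml -big_split.
apply: big1 => A _ /=; have [->|/hx] := eqVneq (x A) 0.
  by rewrite scale0r mulr0 mul0r addr0.
case=> /eqP/cards1P[l ->].
by rewrite -scalerAr -scalerAl -scalerDr [X in X + _]ext_gen_anticomm addNr scaler0.
Qed.

End ExteriorSupport.

(** Chain maps and homotopies are built degree by degree from mere existence statements, in types
    that vary with the degree; the invariant [P] keeps the next step possible. *)
Lemma dependent_choice (T : nat -> Type) (P : forall i, T i -> Prop)
    (R : forall i, T i -> T i.+1 -> Prop) (x0 : T 0%N) :
  P 0%N x0 -> (forall i x, P i x -> exists y, P i.+1 y /\ R i x y) ->
  exists f : forall i, T i,
    f 0%N = x0 /\ forall i, P i (f i) /\ R i (f i) (f i.+1).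
Proof.
move=> Px0 step.
pose next i (x : {x | P i x}) :=
  constructive_indefinite_description _ (step i (sval x) (svalP x)).
pose g := nat_rect (fun i => {x | P i x}) (exist _ x0 Px0)
  (fun i x => exist _ (sval (next i x)) (svalP (next i x)).1).
exists (fun i => sval (g i)); split=> // i; split; first exact: svalP.
exact: (svalP (next i (g i))).2.
Qed.

(** * Graded matrices and the comparison theorem *)

Section GradedMatrices.

Variables (K : fieldType) (n : nat).
Local Notation E := (exterior K n).

Definition graded_mx m1 m2 (p : 'I_m1 -> int) (q : 'I_m2 -> int)
    (M : 'M[E]_(m1, m2)) :=
  forall a b, M a b \in homog K n (p a - q b).

Lemma graded_mx0 m1 m2 (p : 'I_m1 -> int) (q : 'I_m2 -> int) :
  graded_mx p q 0.
Proof. by move=> a b; rewrite mxE mem0v. Qed.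

Lemma graded_mxN m1 m2 (p : 'I_m1 -> int) (q : 'I_m2 -> int) M :
  graded_mx p q M -> graded_mx p q (- M).
Proof. by move=> gM a b; rewrite mxE memvN. Qed.

Lemma graded_mxM m1 m2 m3 (p : 'I_m1 -> int) (q : 'I_m2 -> int)
    (r : 'I_m3 -> int) M N :
  graded_mx p q M -> graded_mx q r N -> graded_mx p r (M *m N).
Proof.
move=> gM gN a b; rewrite mxE; apply: memv_suml => c _.
by rewrite -(subrK (q c) (p a)) -addrA; apply: homogM.
Qed.

Definition catdeg m1 m2 (p1 : 'I_m1 -> int) (p2 : 'I_m2 -> int) (a : 'I_(m1 + m2)) :=
  match split a with inl a1 => p1 a1 | inr a2 => p2 a2 end.

Lemma graded_col_mx m1 m2 m3 (p1 : 'I_m1 -> int) (p2 : 'I_m2 -> int)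
    (q : 'I_m3 -> int) M1 M2 :
  graded_mx p1 q M1 -> graded_mx p2 q M2 ->
  graded_mx (catdeg p1 p2) q (col_mx M1 M2).
Proof. by move=> g1 g2 a b; rewrite mxE /catdeg; case: split => c. Qed.

Lemma graded_row_mx m1 m2 m3 (p : 'I_m1 -> int) (q1 : 'I_m2 -> int)
    (q2 : 'I_m3 -> int) M1 M2 :
  graded_mx p q1 M1 -> graded_mx p q2 M2 ->
  graded_mx p (catdeg q1 q2) (row_mx M1 M2).
Proof. by move=> g1 g2 a b; rewrite mxE /catdeg; case: split => c. Qed.

Lemma graded_block_mx m1 m2 m3 m4 (p1 : 'I_m1 -> int) (p2 : 'I_m2 -> int)
    (q1 : 'I_m3 -> int) (q2 : 'I_m4 -> int) M11 M12 M21 M22 :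
  graded_mx p1 q1 M11 -> graded_mx p1 q2 M12 ->
  graded_mx p2 q1 M21 -> graded_mx p2 q2 M22 ->
  graded_mx (catdeg p1 p2) (catdeg q1 q2) (block_mx M11 M12 M21 M22).
Proof. by move=> *; apply: graded_col_mx; apply: graded_row_mx. Qed.

(** Replacing each entry of a factor by its component of the expected degree preserves the equation,
    because [M] and [D] are homogeneous. *)
Lemma graded_factor m1 m2 m3 (p : 'I_m1 -> int) (q : 'I_m2 -> int)
    (r : 'I_m3 -> int) (M : 'M[E]_(m1, m3)) (D : 'M[E]_(m2, m3)) :
  graded_mx p r M -> graded_mx q r D -> (exists N, M = N *m D) ->
  exists2 N, graded_mx p q N & M = N *m D.
Proof.
move=> gM gD [N eM]; exists (\matrix_(a, b) hproj (p a - q b) (N a b)).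
  by move=> a b; rewrite mxE hproj_homog.
apply/matrixP=> a c; rewrite -[LHS](hproj_id (gM a c)) eM !mxE hproj_sum.
apply: eq_bigr => b _; rewrite mxE -(hprojM _ _ (gD b c)).
by rewrite addrA subrK.
Qed.

Lemma row_factor m1 m2 m3 (M : 'M[E]_(m1, m3)) (D : 'M[E]_(m2, m3)) :
  (forall a, exists w : 'rV_m2, row a M = w *m D) -> exists N, M = N *m D.
Proof.
move=> /fin_all_exists[w ew]; exists (\matrix_a w a).
by apply/row_matrixP => a; rewrite row_mul rowK.
Qed.

Lemma exact_mul0 m1 m2 m3 (D1 : 'M[E]_(m1, m2)) (D2 : 'M[E]_(m2, m3)) :
  is_exact D1 D2 -> D1 *m D2 = 0.
Proof.
move=> ex; apply/row_matrixP => a; rewrite row_mul row0; apply/ex.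
by exists (delta_mx 0 a); rewrite rowE.
Qed.

Lemma exact_factor m m1 m2 m3 (D1 : 'M[E]_(m1, m2)) (D2 : 'M[E]_(m2, m3))
    (M : 'M[E]_(m, m2)) :
  is_exact D1 D2 -> M *m D2 = 0 -> exists N, M = N *m D1.
Proof.
by move=> ex M0; apply: row_factor => a; apply/ex; rewrite -row_mul M0 row0.
Qed.

Section Chains.

Variables (q r : nat -> nat).
Variables (dq : forall i, 'I_(q i) -> int) (dr : forall i, 'I_(r i) -> int).
Variables (D : forall i, 'M[E]_(q i.+1, q i)) (C : forall i, 'M[E]_(r i.+1, r i)).
Hypothesis gD : forall i, graded_mx (@dq i.+1) (@dq i) (D i).
Hypothesis gC : forall i, graded_mx (@dr i.+1) (@dr i) (C i).
Hypothesis DD0 : forall i, D i.+1 *m D i = 0.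
Hypothesis exC : forall i, is_exact (C i.+1) (C i).

(** The source only has to be a complex of free modules; exactness is used in the target alone. The
    invariant of the recursion is that [D i *m phi i] factors through [C i]. *)
Lemma chain_lift (phi0 : 'M[E]_(q 0, r 0)) :
  graded_mx (@dq 0) (@dr 0) phi0 -> (exists N, D 0 *m phi0 = N *m C 0) ->
  exists phi : forall i, 'M[E]_(q i, r i),
    [/\ phi 0%N = phi0, forall i, graded_mx (@dq i) (@dr i) (phi i)
      & forall i, phi i.+1 *m C i = D i *m phi i].
Proof.
move=> g0 ex0.
have [||phi [phi_0 phiP]] := @dependent_choice (fun i => 'M[E]_(q i, r i))
  (fun i phi => graded_mx (@dq i) (@dr i) phi /\ exists N, D i *m phi = N *m C i)
  (fun i phi phi' => phi' *m C i = D i *m phi) phi0; first by split.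
- move=> i phi [gphi exphi].
  have [N gN eN] := graded_factor (graded_mxM (gD (i := i)) gphi) (gC (i := i)) exphi.
  exists N; split; last exact/esym.
  split=> //; apply: (exact_factor (@exC i)).
  by rewrite -mulmxA -eN mulmxA DD0 mul0mx.
by exists phi; split=> // i; case: (phiP i) => [[]].
Qed.

Lemma null_homotopy (f : forall i, 'M[E]_(r i, r i)) :
  f 0%N = 0 -> (forall i, f i.+1 *m C i = C i *m f i) ->
  exists h : forall i, 'M[E]_(r i, r i.+1),
    h 0%N = 0 /\ forall i, f i.+1 = h i.+1 *m C i.+1 + C i *m h i.
Proof.
move=> f0 fC.
have [||h [h0 hP]] := @dependent_choice (fun i => 'M[E]_(r i, r i.+1))
  (* The defect left by the homotopy so far is a cycle; exactness then yields the next homotopy. *)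
  (fun i h => (f i.+1 - C i *m h) *m C i = 0)
  (fun i h h' => f i.+1 = h' *m C i.+1 + C i *m h) 0.
- by rewrite mulmx0 subr0 fC f0 mulmx0.
- move=> i h /(exact_factor (@exC i))[h' eh']; exists h'.
  have ef : f i.+1 = h' *m C i.+1 + C i *m h by rewrite -eh' subrK.
  split=> //; rewrite mulmxBl fC ef mulmxDr [C i.+1 *m (C i *m h)]mulmxA.
  by rewrite (exact_mul0 (@exC i)) mul0mx addr0 mulmxA subrr.
by exists h; split=> // i; case: (hP i).
Qed.

End Chains.

(** The augmented complex: [E] sits in position 0 and [F] is shifted up by one, so that [aug] and
    [diff] form a single family of maps. *)
Definition arank (F : free_complex K n) (i : nat) : nat :=
  if i is i'.+1 then rk F i' else 1.

Definition adeg (F : free_complex K n) (i : nat) : 'I_(arank F i) -> int :=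
  if i is i'.+1 then @gdeg _ _ F i' else fun=> 0.

Definition adiff (F : free_complex K n) (i : nat) :
    'M[E]_(arank F i.+1, arank F i) :=
  if i is i'.+1 then diff F i' else aug F.

Lemma resolution_graded I F i : is_graded_free_resolution I F ->
  graded_mx (@adeg F i.+1) (@adeg F i) (adiff F i).
Proof.
case=> -[ga gd] _ _ _; case: i => [|i] a b /=; last exact: gd.
by rewrite subr0 ord1.
Qed.

Lemma resolution_exact I F i : is_graded_free_resolution I F ->
  is_exact (adiff F i.+1) (adiff F i).
Proof. by case=> _ _ ex0 ex; case: i => [|i] /=. Qed.

(** The identity of [E] lifts, since both augmentations have image [I]. *)
Lemma resolution_compare I F G :
  is_graded_free_resolution I F -> is_graded_free_resolution I G ->
  exists phi : forall i, 'M[E]_(arank F i, arank G i),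
    [/\ phi 0%N = 1%:M, forall i, graded_mx (@adeg F i) (@adeg G i) (phi i)
      & forall i, phi i.+1 *m adiff G i = adiff F i *m phi i].
Proof.
move=> rF rG; have [_ imF _ _] := rF; have [_ imG _ _] := rG.
apply: chain_lift.
- by move=> i; apply: resolution_graded rF.
- by move=> i; apply: resolution_graded rG.
- by move=> i; apply: exact_mul0; apply: resolution_exact rF.
- by move=> i; apply: resolution_exact rG.
- move=> a b; rewrite !ord1 mxE /= subrr.
  by have := homog_mon K (set0 : {set 'I_n}); rewrite cards0.
rewrite mulmx1; apply: row_factor => a /=.
have /imG[w ew] : aug F a 0 \in I.
  apply/imF; exists (delta_mx 0 a).
  by apply/matrixP=> i j; rewrite -rowE !ord1 !mxE.
by exists w; rewrite -ew; apply/matrixP=> i j; rewrite !ord1 !mxE.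
Qed.

End GradedMatrices.

(** * Tor computed from a minimal resolution *)

Section TorOfResolution.

Variables (K : fieldType) (n : nat) (I : {vspace exterior K n}).
Implicit Types F G : free_complex K n.
Local Notation E := (exterior K n).
Local Notation red := (map_mx (@counit K n)).

Lemma counit_graded m1 m2 (p : 'I_m1 -> int) (q : 'I_m2 -> int) M a b :
  graded_mx p q M -> red M a b != 0 -> p a = q b.
Proof.
move=> gM; rewrite mxE; apply: contraNeq => nab.
by rewrite (homog_counit (gM a b)) // subr_eq0.
Qed.

Lemma tcomp_comm F G (i : nat) (j : int) (M : 'M[E]_(rk F i, rk G i)) :
  graded_mx (@gdeg _ _ F i) (@gdeg _ _ G i) M ->
  tcomp F i j *m red M = red M *m tcomp G i j.
Proof.
move=> gM; apply/matrixP=> a b; rewrite mul_diag_mx mul_mx_diag [LHS]mxE [RHS]mxE.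
rewrite ![(\row__ _) _ _]mxE; have [->|nM] := eqVneq (red M a b) 0.
  by rewrite mulr0 mul0r.
by rewrite (counit_graded gM nM) mulrC.
Qed.

Lemma rank_tcomp F i j :
  \rank (tcomp F i j) = (\sum_(a < rk F i) (gdeg a == j))%N.
Proof.
pose S := [set a : 'I_(rk F i) | gdeg a == j].
have -> : (\sum_(a < rk F i) (gdeg a == j))%N = #|S|.
  by rewrite -sum1_card [RHS]big_mkcond; apply: eq_bigr => a _; rewrite inE.
(* [P] selects the coordinates in [S]: the diagonal projector is [P^T *m P], while
   [P *m P^T = 1%:M]. *)
pose P : 'M[K]_(#|S|, rk F i) := \matrix_(k, a) (enum_val k == a)%:R.
have eP : P *m P^T = 1%:M.
  apply/matrixP=> k l; rewrite !mxE (bigD1 (enum_val k)) //= big1 ?addr0 => [|a nk].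
    by rewrite !mxE eqxx mul1r (inj_eq enum_val_inj) eq_sym.
  by rewrite !mxE eq_sym (negPf nk) mul0r.
have -> : tcomp F i j = P^T *m P.
  apply/matrixP=> a b; rewrite !mxE.
  transitivity (\sum_(c in S) (c == a)%:R * (c == b)%:R : K); last first.
    by rewrite big_enum_val; apply: eq_bigr => k _; rewrite !mxE.
  rewrite big_mkcond (bigD1 a) //= big1 ?addr0 => [|c /negPf nc].
    rewrite inE eqxx mul1r; case: (gdeg a =P j); case: (a =P b) => //=.
  by rewrite nc mul0r if_same.
apply/eqP; rewrite eqn_leq; apply/andP; split.
  exact: leq_trans (mxrankM_maxr _ _) (rank_leq_row _).
rewrite -{1}(mxrank1 K #|S|) -[1%:M]mulmx1 -{2}eP -{1}eP.
rewrite -[_ *m (P *m _)]mulmxA [P^T *m _]mulmxA.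
exact: leq_trans (mxrankM_maxr _ _) (mxrankM_maxl _ _).
Qed.

Lemma tdiffE F i : tdiff F i = red (diff F i).
Proof. by []. Qed.

Lemma tdiff_cycle F i : is_graded_free_resolution I F ->
  (tdiff F i <= tcycles F i)%MS.
Proof.
move=> rF; case: i => [|i] /=; first exact: submx1.
apply/sub_kermxP; rewrite tdiffE [tdiff F i]tdiffE -map_mxM.
by rewrite (exact_mul0 (resolution_exact (i := i.+1) rF)) map_mx0.
Qed.

(** In position 0 everything is a cycle and the map is [aug], so being a cycle gives nothing there;
    hence the condition on [h]. *)
Lemma tcycles_adiff F i m (h : 'M[E]_(arank F i, m)) :
  is_graded_free_resolution I F -> (i = 0%N -> h = 0) ->
  tcycles F i *m red (adiff F i *m h) = 0.
Proof.
case: i h => [|i] h rF h0; first by rewrite h0 // mulmx0 map_mx0 mulmx0.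
by rewrite map_mxM mulmxA /= -tdiffE mulmx_ker mul0mx.
Qed.

Lemma tor_dim_minimal F G :
  is_graded_free_resolution I F -> is_graded_free_resolution I G ->
  (forall i, tdiff G i = 0) ->
  forall i j, tor_dim F i j = (\sum_(a < rk G i) (gdeg a == j))%N.
Proof.
move=> rF rG minG i j.
have [f [f0 gf fC]] := resolution_compare rF rG.
have [g [g0 gg gC]] := resolution_compare rG rF.
pose fg k : 'M[E]_(arank F k) := f k *m g k - 1%:M.
pose gf' k : 'M[E]_(arank G k) := g k *m f k - 1%:M.
have [||hF [hF0 hFP]] := null_homotopy (fun k => resolution_exact (i := k) rF) (f := fg).
- by rewrite /fg f0 g0 mulmx1 subrr.
- move=> k; rewrite /fg mulmxBl mulmxBr mul1mx mulmx1 -mulmxA gC.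
  by rewrite mulmxA fC mulmxA.
have [||hG [hG0 hGP]] := null_homotopy (fun k => resolution_exact (i := k) rG) (f := gf').
- by rewrite /gf' f0 g0 mulmx1 subrr.
- move=> k; rewrite /gf' mulmxBl mulmxBr mul1mx mulmx1 -mulmxA fC.
  by rewrite mulmxA gC mulmxA.
pose fb : 'M[K]_(rk F i, rk G i) := red (f i.+1).
pose gb : 'M[K]_(rk G i, rk F i) := red (g i.+1).
(* Each homotopy term contains a differential of [G], which reduces to 0, or else, in position 0,
   the factor [hG 0 = 0]. *)
have gfb : gb *m fb = 1%:M.
  apply/eqP; rewrite -subr_eq0 -map_mxM -(map_mx1 (@counit K n)) -map_mxB.
  rewrite -[_ - _]/(gf' i.+1) hGP map_mxD !map_mxM /= -tdiffE minG mulmx0 add0r.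
  case: i {fb gb} => [|k] /=; first by rewrite hG0 map_mx0 mulmx0.
  by rewrite -tdiffE minG mul0mx.
(* On cycles of [F], the other composite is the identity modulo boundaries. *)
have fgb : (tcycles F i *m (fb *m gb - 1%:M) <= tdiff F i)%MS.
  rewrite -map_mxM -(map_mx1 (@counit K n)) -map_mxB -[_ - _]/(fg i.+1) hFP.
  rewrite map_mxD mulmxDr tcycles_adiff // ?addr0; last by move=> ->.
  by rewrite map_mxM mulmxA submxMl.
have dfb : tdiff F i *m fb = 0.
  by rewrite tdiffE -map_mxM -(fC i.+1) map_mxM /= -tdiffE minG mulmx0.
have gbZ : (gb <= tcycles F i)%MS.
  case: i @fb @gb gfb fgb dfb => [|k] fb gb _ _ _ /=; first exact: submx1.
  apply/sub_kermxP; rewrite tdiffE -map_mxM (gC k.+1) map_mxM /= -tdiffE.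
  by rewrite minG mul0mx.
have fbC : tcomp F i j *m fb = fb *m tcomp G i j by apply: tcomp_comm (gf i.+1).
have gbC : tcomp G i j *m gb = gb *m tcomp F i j by apply: tcomp_comm (gg i.+1).
(* Rank-nullity for [fb] on the cycles of degree [j]: the image is all of degree [j] in [G], because
   [gb] is a section with values in cycles, and the kernel consists of the boundaries. *)
rewrite -rank_tcomp /tor_dim -(mxrank_mul_ker _ fb).
have -> : \rank ((tcycles F i :&: tcomp F i j)%MS *m fb) = \rank (tcomp G i j).
  apply/eqmx_rank/andP; split.
    apply: submx_trans (submxMr _ (capmxSr _ _)) _.
    by rewrite fbC submxMl.
  rewrite -[X in (X <= _)%MS]mulmx1 -gfb mulmxA submxMr // sub_capmx.
  by rewrite (submx_trans (submxMl _ _) gbZ) gbC submxMl.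
have -> : \rank ((tcycles F i :&: tcomp F i j) :&: kermx fb)%MS =
          \rank (tdiff F i :&: tcomp F i j)%MS.
  apply/eqmx_rank/andP; split; last first.
    rewrite !sub_capmx capmxSr (submx_trans (capmxSl _ _) (tdiff_cycle i rF)) /=.
    by apply: submx_trans (capmxSl _ _) _; apply/sub_kermxP.
  rewrite sub_capmx (submx_trans (capmxSl _ _) (capmxSr _ _)) andbT.
  set X := (_ :&: kermx fb)%MS.
  have /sub_kermxP X0 : (X <= kermx fb)%MS by apply: capmxSr.
  have /submxP[W eW] : (X <= tcycles F i)%MS.
    exact: submx_trans (capmxSl _ _) (capmxSl _ _).
  (* As [X *m fb = 0], [- X] equals [X *m (fb *m gb - 1%:M)], a boundary by [fgb]. *)
  rewrite -eqmx_opp -[- X]add0r -(mul0mx _ gb) -X0 -mulmxA -[X in _ - X]mulmx1.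
  by rewrite -mulmxBr eW -mulmxA mulmx_sub.
by rewrite addnK.
Qed.

Lemma tor_total_dim_minimal F G :
  is_graded_free_resolution I F -> is_graded_free_resolution I G ->
  (forall i, tdiff G i = 0) ->
  forall i, tor_total_dim F i = rk G i.
Proof.
move=> rF rG minG i; rewrite /tor_total_dim.
under eq_bigr => j _ do rewrite (tor_dim_minimal rF rG minG).
rewrite exchange_big /= -[RHS]card_ord -sum1_card; apply: eq_bigr => a _.
have [aF|aF] := boolP (gdeg a \in codom (@gdeg _ _ F i)).
  rewrite (bigD1_seq (gdeg a)) ?mem_undup ?undup_uniq //= eqxx big1 // => j.
  by rewrite eq_sym => /negPf->.
(* A degree of [G] absent from [F] would have no Tor, yet the count in [G] includes [a]; so the sum
   over degrees of [F] misses nothing. *)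
have : tor_dim F i (gdeg a) = 0%N.
  rewrite /tor_dim; apply/eqP; rewrite -leqn0; apply: leq_trans (leq_subr _ _) _.
  apply: leq_trans (mxrankS (capmxSr _ _)) _.
  rewrite rank_tcomp big1 // => b _; case: eqP => // eb.
  by rewrite -eb codom_f in aF.
rewrite (tor_dim_minimal rF rG minG) => /eqP; rewrite sum_nat_eq0.
by move=> /forallP/(_ a); rewrite eqxx.
Qed.

End TorOfResolution.

(** * The Cartan resolution and mapping cones *)

Section ConeExactness.

Variables (K : fieldType) (n : nat).
Local Notation E := (exterior K n).

(** Exactness inside a mapping cone: solve in the [D] component, then correct the [C] component. The
    maps [phi] anticommute with the differentials, so the blocks carry no signs. *)
Lemma exact_block_mx a3 a2 a1 b3 b2 b1 (C2 : 'M[E]_(a3, a2)) (C1 : 'M[E]_(a2, a1))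
    (D2 : 'M[E]_(b3, b2)) (D1 : 'M[E]_(b2, b1)) (phi2 : 'M[E]_(b3, a2))
    (phi1 : 'M[E]_(b2, a1)) :
  is_exact C2 C1 -> is_exact D2 D1 -> phi2 *m C1 + D2 *m phi1 = 0 ->
  is_exact (block_mx C2 0 phi2 D2) (block_mx C1 0 phi1 D1).
Proof.
move=> exC exD anti v; split=> [|[w ->]]; last first.
  rewrite -mulmxA mulmx_block anti (exact_mul0 exC) (exact_mul0 exD).
  by rewrite !mulmx0 !mul0mx !addr0 block_mx0 mulmx0.
rewrite -[v]hsubmxK mul_row_block mulmx0 add0r -[0]row_mx0.
case/eq_row_mx=> eC /exD[w2 ew2].
have /exC[w1 ew1] : (lsubmx v - w2 *m phi2) *m C1 = 0.
  rewrite mulmxBl -mulmxA; move/eqP: anti; rewrite addr_eq0 => /eqP->.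
  by rewrite mulmxN opprK mulmxA -ew2.
exists (row_mx w1 w2).
by rewrite mul_row_block mulmx0 add0r -ew1 -ew2 subrK.
Qed.

(** At the end of the cone, exactness of [D] is replaced by a colon condition: what [phi0] sends
    into the image of [C0] lies in the image of [D1]. *)
Lemma exact_block_col_mx a2 a1 a0 b2 b1 (C1 : 'M[E]_(a2, a1)) (C0 : 'M[E]_(a1, a0))
    (D1 : 'M[E]_(b2, b1)) (phi1 : 'M[E]_(b2, a1)) (phi0 : 'M[E]_(b1, a0)) :
  is_exact C1 C0 -> phi1 *m C0 + D1 *m phi0 = 0 ->
  (forall (y : 'rV_b1) (w : 'rV_a1), y *m phi0 = w *m C0 ->
     exists w' : 'rV_b2, y = w' *m D1) ->
  is_exact (block_mx C1 0 phi1 D1) (col_mx C0 phi0).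
Proof.
move=> exC anti colon_phi v; split=> [|[w ->]]; last first.
  by rewrite -mulmxA mul_block_col anti (exact_mul0 exC) mul0mx addr0 col_mx0 mulmx0.
rewrite -[v]hsubmxK mul_row_col => /eqP; rewrite addrC addr_eq0 -mulNmx => /eqP e0.
have [w2 ew2] := colon_phi _ _ e0.
have /exC[w1 ew1] : (lsubmx v - w2 *m phi1) *m C0 = 0.
  rewrite mulmxBl -mulmxA; move/eqP: anti; rewrite addr_eq0 => /eqP->.
  by rewrite mulmxN opprK mulmxA -ew2 e0 mulNmx subrr.
exists (row_mx w1 w2).
by rewrite mul_row_block mulmx0 add0r -ew1 -ew2 subrK.
Qed.

Lemma mem_image_col_mx m (J J' : {vspace E}) (C : 'M[E]_(m, 1)) (u : E) :
  (forall x, x \in J <-> exists w : 'rV_m, x%:M = w *m C) ->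
  (forall x, x \in J' <-> exists y z, y \in J /\ x = y + z * u) ->
  forall x, x \in J' <-> exists w : 'rV_(m + 1), x%:M = w *m col_mx C u%:M.
Proof.
move=> imC imJ' x; split=> [/imJ'[y [z [/imC[w ew] ->]]]|[w]].
  exists (row_mx w z%:M); rewrite mul_row_col -ew.
  by rewrite -scalar_mxM -raddfD.
rewrite -[w]hsubmxK mul_row_col => /matrixP/(_ 0 0) ex; apply/imJ'.
exists ((lsubmx w *m C) 0 0), (rsubmx w 0 0); split.
  by apply/imC; exists (lsubmx w); rewrite -mx11_scalar.
move: ex; rewrite !mxE eqxx mulr1n => ->; congr (_ + _).
by rewrite big_ord1 !mxE eqxx mulr1n.
Qed.

End ConeExactness.

Section CartanResolution.

Variables (K : fieldType) (n : nat).
Local Notation E := (exterior K n).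
Local Notation var_ideal T := (ideal_gen [seq ext_gen K l | l <- enum T]).

Section Step.

Variables (F : free_complex K n) (k : 'I_n).

(* The Cartan complex of [T] is [E[x_l : l in T]], the divided power [x^(a)]
   mapping to [sum_l e_l x^(a - l)]. Adding a variable [x_k], the part
   of degree [i.+1] splits as the part of degree [i.+1] for [T] plus [x_k] times
   the part of degree [i] for [k |: T]. *)
Fixpoint cartan_rk i := if i is i'.+1 then (rk F i' + cartan_rk i')%N else 1%N.

(** The component of the differential from [x_k] times a divided monomial to the part without [x_k]:
    it is [e_k] if the monomial is free of [x_k], and 0 otherwise. *)
Definition cartan_phi i : 'M[E]_(cartan_rk i, arank F i) :=
  if i is i'.+1 then col_mx (ext_gen K k)%:M 0 else (ext_gen K k)%:M.

Fixpoint cartan_diff i : 'M[E]_(cartan_rk i.+1, cartan_rk i) :=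
  match i return 'M[E]_(cartan_rk i.+1, cartan_rk i) with
  | 0 => col_mx (aug F) (ext_gen K k)%:M
  | i'.+1 => block_mx (diff F i') 0 (cartan_phi i'.+1) (cartan_diff i')
  end.

Definition cartan_cone : free_complex K n :=
  @FreeComplex K n (fun i => cartan_rk i.+1) (fun i _ => i.+1%:Z)
    (cartan_diff 0) (fun i => cartan_diff i.+1).

Variable T : {set 'I_n}.
Hypotheses (kT : k \notin T) (rF : is_graded_free_resolution (var_ideal T) F).
Hypothesis degF : forall i a, @gdeg _ _ F i a = i.+1%:Z.

Lemma homog_ext_gen : ext_gen K k \in homog K n 1.
Proof. by have := homog_mon K [set k]; rewrite cards1. Qed.

Lemma adiff_homog i a b : adiff F i a b \in homog K n 1.
Proof.
have := resolution_graded (i := i) rF a b.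
case: i a b => [|i] a b /=; rewrite !degF ?subr0 //.
by rewrite (_ : _ - _ = 1) //; lia.
Qed.

Lemma cartan_diff_homog i a b : cartan_diff i a b \in homog K n 1.
Proof.
have hs m (c d : 'I_m) : (ext_gen K k)%:M c d \in homog K n 1.
  rewrite mxE; case: (c == d); last by rewrite mulr0n mem0v.
  by rewrite mulr1n homog_ext_gen.
elim: i a b => [|i IHi] a b /=.
  by rewrite mxE; case: split => c; rewrite ?hs ?(adiff_homog (i := 0)).
rewrite mxE; case: split => c; rewrite mxE; case: split => d.
- exact: (adiff_homog (i := i.+1)).
- by rewrite mxE mem0v.
- by rewrite mxE; case: split => c'; rewrite ?hs // mxE mem0v.
- exact: IHi.
Qed.

Lemma ext_gen_anticomm_mx m1 m2 (M : 'M[E]_(m1, m2)) :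
  (forall a b, M a b \in homog K n 1) ->
  (ext_gen K k)%:M *m M + M *m (ext_gen K k)%:M = 0.
Proof.
move=> hM; apply/matrixP=> a b; rewrite mul_scalar_mx !mxE.
rewrite [X in _ + X](bigD1 b) //= [X in _ + (_ + X)]big1 => [|c /negPf nc].
  by rewrite mxE eqxx mulr1n addr0 ext_gen_homog_anticomm.
by rewrite mxE nc mulr0.
Qed.

(** [e_k] anticommutes with the linear entries of [F], and the remaining composite contains the
    square of [e_k]. *)
Lemma cartan_phi_anticomm i :
  cartan_phi i.+1 *m adiff F i + cartan_diff i *m cartan_phi i = 0.
Proof.
have sqr0 m : (ext_gen K k)%:M *m (ext_gen K k)%:M = 0 :> 'M[E]_m.
  by rewrite -scalar_mxM ext_gen_sqr raddf0.
case: i => [|i] /=.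
  rewrite !mul_col_mx mul0mx sqr0 add_col_mx addr0.
  by rewrite ext_gen_anticomm_mx ?col_mx0 //; apply: (adiff_homog (i := 0)).
rewrite mul_block_col mul_col_mx mul0mx !mulmx0 !addr0 add_col_mx add0r.
rewrite ext_gen_anticomm_mx; last exact: (adiff_homog (i := i.+1)).
by case: i => [|i] /=; rewrite ?mul_col_mx ?mul0mx sqr0 ?col_mx0.
Qed.

Lemma mem_var_idealU1 x : x \in var_ideal (k |: T) <->
  exists y z, y \in var_ideal T /\ x = y + z * ext_gen K k.
Proof.
have e (T' : {set 'I_n}) : var_ideal T' = mon_ideal K [seq [set l] | l <- enum T'].
  by rewrite /mon_ideal -map_comp.
have eU : mon_ideal K [seq [set l] | l <- enum (k |: T)] =
          mon_ideal K (rcons [seq [set l] | l <- enum T] [set k]).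
  apply: mon_ideal_eq_mem; rewrite -map_rcons; apply: eq_mem_map => l.
  by rewrite mem_rcons !inE !mem_enum !inE.
by rewrite !e eU; apply: mem_mon_ideal_rcons.
Qed.

(** The cone joins the complex of [T] to a shifted copy of the complex under construction, so
    exactness in one position gives the next. The start is [var_ideal_colon]: the colon ideal is the
    very ideal that the new augmentation generates. *)
Lemma cartan_cone_resolution :
  is_graded_free_resolution (var_ideal (k |: T)) cartan_cone.
Proof.
have [_ imF _ _] := rF.
have im := mem_image_col_mx imF mem_var_idealU1.
have ex i : is_exact (cartan_diff i.+1) (cartan_diff i).
  elim: i => [|i IHi].
    apply: (exact_block_col_mx (resolution_exact (i := 0) rF) (cartan_phi_anticomm 0)).
    move=> y w; rewrite [y]mx11_scalar -scalar_mxM => ey; apply/im.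
    by rewrite -var_ideal_colon //; apply/imF; exists w.
  exact: (exact_block_mx (resolution_exact (i := i.+1) rF) IHi (cartan_phi_anticomm i.+1)).
split; [|exact: im|exact: (ex 0%N)|by move=> i; apply: (ex i.+1)].
split=> [a|i a b] /=; first exact: (cartan_diff_homog (i := 0)).
rewrite (_ : _ - _ = 1); last by lia.
exact: (cartan_diff_homog (i := i.+1)).
Qed.

End Step.

Lemma cartan_resolution (T : {set 'I_n}) :
  exists G : free_complex K n,
    [/\ is_graded_free_resolution (var_ideal T) G,
        forall i a, @gdeg _ _ G i a = i.+1%:Z
      & forall i, arank G i = if #|T| is t.+1 then 'C(i + t, t) else (i == 0)%N].
Proof.
have [m] := ubnP #|T|; elim: m T => // m IHm T.
(* Without variables the ideal is 0 and the zero complex resolves it; only [E] in position 0 of the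
   augmented complex remains. *)
have [->|[k kT]] := set_0Vmem T => cT.
  pose G : free_complex K n :=
    @FreeComplex K n (fun=> 0%N) (fun i _ => i.+1%:Z) 0 (fun=> 0).
  exists G; split=> [||[|i]]; rewrite ?cards0 //.
  have ex p : is_exact (0 : 'M[E]_(0, 0)) (0 : 'M[E]_(0, p)).
    move=> v; split=> _; first by exists 0; rewrite [v]thinmx0 mul0mx.
    by rewrite [v]thinmx0 mul0mx.
  split=> //; first by split=> [[]|i []].
  move=> x; split=> [/mem_var_ideal sx|[w]].
    exists 0; rewrite mul0mx (_ : x = 0) ?raddf0 //.
    apply/ffunP=> A; rewrite ffunE; apply/eqP/contraT => /sx /=.
    by rewrite set0I eqxx.
  by rewrite mulmx0 => /matrixP/(_ 0 0); rewrite !mxE eqxx mulr1n => ->; rewrite mem0v.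
have kTk : k \notin T :\ k by rewrite !inE eqxx.
have cTk : #|T| = #|T :\ k|.+1 by rewrite (cardsD1 k T) kT.
have [|F [rF degF rkF]] := IHm (T :\ k); first by rewrite cTk in cT.
exists (cartan_cone F k); split=> //.
  by have := cartan_cone_resolution kTk rF degF; rewrite setD1K.
have e i : arank (cartan_cone F k) i = cartan_rk F i by case: i.
rewrite cTk => i; rewrite e; elim: i => [|i IHi] /=; first by rewrite binn.
(* The splitting by divisibility by [x_k] is Pascal's rule. *)
rewrite IHi -[rk F i]/(arank F i.+1) rkF; case: #|T :\ k| => [|t].
  by rewrite !bin0.
by rewrite addnS addSn binS addnS addnC.
Qed.

End CartanResolution.

Section MappingCone.

Variables (K : fieldType) (n : nat).
Local Notation E := (exterior K n).
Local Notation var_ideal T := (ideal_gen [seq ext_gen K l | l <- enum T]).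
Variables (J : seq {set 'I_n}) (u T : {set 'I_n}) (P Q : free_complex K n).
Hypotheses (rP : is_graded_free_resolution (mon_ideal K J) P).
Hypotheses (rQ : is_graded_free_resolution (var_ideal T) Q).
Hypothesis degQ : forall i a, @gdeg _ _ Q i a = i.+1%:Z.
Hypothesis colonT : colon (mon_ideal K J) (mon K u) = var_ideal T.

Definition shift_adeg i : 'I_(arank Q i) -> int := fun a => adeg a + #|u|%:Z.

Lemma cone_lift :
  exists phi : forall i, 'M[E]_(arank Q i, arank P i),
    [/\ phi 0%N = (mon K u)%:M,
        forall i, graded_mx (@shift_adeg i) (@adeg _ _ P i) (phi i)
      & forall i, phi i.+1 *m adiff P i + adiff Q i *m phi i = 0].
Proof.
have [_ imP _ _] := rP; have [_ imQ _ _] := rQ.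
have [|||||| phi [phi0 gphi phiC]] := @chain_lift K n (arank Q) (arank P)
  (* Lifting along the negated differential of [Q] yields the anticommuting maps that the cone
     lemmas expect. *)
  shift_adeg (@adeg _ _ P) (fun i => - adiff Q i) (adiff P) _ _ _ _ (mon K u)%:M.
- move=> i; apply: graded_mxN => a b; rewrite /shift_adeg opprD addrACA subrr addr0.
  exact: resolution_graded rQ a b.
- by move=> i; apply: resolution_graded rP.
- by move=> i; rewrite mulmxN mulNmx opprK (exact_mul0 (resolution_exact (i := i) rQ)).
- by move=> i; apply: resolution_exact rP.
- by move=> a b; rewrite !ord1 mxE /shift_adeg /= add0r subr0 homog_mon.
- apply: row_factor => a /=.
  have : - aug Q a 0 \in var_ideal T.
    rewrite memvN; apply/imQ; exists (delta_mx 0 a).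
    by apply/matrixP=> i j; rewrite -rowE !ord1 !mxE.
  rewrite -colonT mem_colon => /imP[w ew]; exists w; rewrite -ew.
  rewrite row_mul [row a _]mx11_scalar -scalar_mxM; congr (_ * _)%:M.
  by rewrite !mxE.
exists phi; split=> // i.
by rewrite phiC mulNmx addNr.
Qed.

Hypothesis degP : forall i a, (@gdeg _ _ P i a <= i%:Z + #|u|%:Z)%R.
Hypothesis minP : forall i, tdiff P i = 0.

(** Position [i] gains the basis of position [i] of the augmented complex of [Q], all of it in
    degree [i] plus the degree of [u]. Counting with an arbitrary predicate covers graded numbers,
    total ranks and degree bounds at once. *)
Lemma cone_resolution :
  exists G : free_complex K n,
    [/\ is_graded_free_resolution (mon_ideal K (rcons J u)) G,
        forall i, tdiff G i = 0
      & forall i (p : pred int), (\sum_(a < rk G i) p (gdeg a) =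
          \sum_(a < rk P i) p (gdeg a) + arank Q i * p (i%:Z + #|u|%:Z)%R)%N].
Proof.
have [phi [phi0 gphi phiC]] := cone_lift.
have [_ imP _ _] := rP; have [_ imQ _ _] := rQ.
have adegQ i a : @adeg _ _ Q i a = i by case: i a => [|i] a //=; rewrite degQ.
pose G := @FreeComplex K n (fun i => rk P i + arank Q i)%N
  (fun i => catdeg (@gdeg _ _ P i) (@shift_adeg i))
  (col_mx (aug P) (phi 0%N))
  (fun i => block_mx (diff P i) 0 (phi i.+1) (adiff Q i)).
exists G; split=> //.
- have ga := graded_col_mx (resolution_graded (i := 0) rP) (gphi 0%N).
  split; last 1 first.
  + move=> i; apply: exact_block_mx (phiC i.+1).
      exact: (resolution_exact (i := i.+1) rP).
    exact: resolution_exact rQ.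
  + split=> [a|i] /=; first by have := ga a 0; rewrite subr0.
    apply: graded_block_mx.
    * exact: (resolution_graded (i := i.+1) rP).
    * exact: graded_mx0.
    * exact: (gphi i.+1).
    move=> a b; rewrite /shift_adeg opprD addrACA subrr addr0.
    exact: resolution_graded rQ a b.
  + rewrite /= phi0; apply: mem_image_col_mx imP _ => x.
    exact: mem_mon_ideal_rcons.
  apply: (exact_block_col_mx (resolution_exact (i := 0) rP) (phiC 0%N)).
  move=> y w; rewrite phi0 [y]mx11_scalar -scalar_mxM => ey.
  by apply/imQ; rewrite -colonT mem_colon; apply/imP; exists w.
- move=> i; rewrite tdiffE /= map_block_mx -tdiffE minP map_mx0.
  (* By [degP] the entries of [phi i.+1] outside degree at least 1 are 0, so none has a constant
     term. *)
  have -> : map_mx (@counit K n) (phi i.+1) = 0.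
    apply/matrixP=> a b; rewrite [RHS]mxE; apply/eqP/contraT.
    move/(counit_graded (gphi i.+1)); rewrite /shift_adeg adegQ => e.
    by have := degP b; rewrite -[gdeg b]/(adeg (b : 'I_(arank P i.+1))) -e; lia.
  have -> : map_mx (@counit K n) (adiff Q i) = 0; last by rewrite block_mx0.
  apply/matrixP=> a b; rewrite [RHS]mxE; apply/eqP/contraT.
  by move/(counit_graded (resolution_graded rQ)); rewrite !adegQ; lia.
move=> i p; rewrite /= big_split_ord /=; congr addn.
  by apply: eq_bigr => a _; rewrite /catdeg (unsplitK (inl a)).
rewrite (eq_bigr (fun=> p (i%:Z + #|u|%:Z) : nat)) ?sum_nat_const ?card_ord //.
by move=> a _; rewrite /catdeg (unsplitK (inr a)) /shift_adeg adegQ.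
Qed.

End MappingCone.

(** * Iterated cones along an order with linear quotients *)

Section LinearQuotients.

Variables (K : fieldType) (n : nat).
Local Notation E := (exterior K n).

(** A finite generating set contains a minimal one, so the default value in [mingens] is not
    reached. *)
Lemma mon_ideal_mingens (I : {vspace E}) :
  is_monomial_ideal I -> mon_ideal K (enum (mingens I)) = I.
Proof.
rewrite /mingens => /existsP[S SI]; case: pickP => [G /minsetp /eqP //|none].
have [|G minG _] := @minset_exists _
  [pred S : {set {set 'I_n}} | mon_ideal K (enum S) == I] S.
  by rewrite /= eq_sym.
by have := none G; rewrite minG.
Qed.

Lemma mon_ideal_set0 (s : seq {set 'I_n}) :
  set0 \in s -> mon_ideal K s = fullv.
Proof.
move=> s0; apply/vspaceP=> x; rewrite memvf; apply/mem_mon_ideal => A _ /=.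
by apply/hasP; exists set0; rewrite ?sub0set.
Qed.

(** A variable dividing [u] annihilates it. Hence [lqset K s u] is nonempty for nonempty [u], and
    the truncated subtractions in the binomials are genuine. *)
Lemma supp_sub_lqset (s : seq {set 'I_n}) (u : {set 'I_n}) : u \subset lqset K s u.
Proof.
apply/subsetP=> k ku; rewrite inE mem_colon [_ * _]ext_mul_mon /mon_mul.
by rewrite disjoints1 ku mem0v.
Qed.

Lemma prev_colon_rcons (p q : seq {set 'I_n}) (u : {set 'I_n}) : uniq (rcons p u ++ q) ->
  prev_colon K (rcons p u ++ q) u = colon (mon_ideal K p) (mon K u).
Proof.
rewrite cat_uniq rcons_uniq => /andP[/andP[pu _] _].
rewrite /prev_colon -cats1 -catA index_cat (negPf pu) /= eqxx addn0.
by rewrite take_size_cat.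
Qed.

Lemma linear_quotients_resolution (s p q : seq {set 'I_n}) :
    s = p ++ q -> uniq s -> set0 \notin s -> degree_increasing s ->
    all (fun u => [exists T : {set 'I_n},
      prev_colon K s u == ideal_gen [seq ext_gen K k | k <- enum T]]) s ->
  exists G : free_complex K n,
    [/\ is_graded_free_resolution (mon_ideal K p) G,
        forall i, tdiff G i = 0
      & forall i (d : pred int), (\sum_(a < rk G i) d (gdeg a) =
          \sum_(u <- p) 'C(i + #|lqset K s u| - 1, #|lqset K s u| - 1)
                        * d (i%:Z + #|u|%:Z)%R)%N].
Proof.
move=> + uniq_s s0 incr_s /allP colon_s.
(* The induction runs over prefixes of a fixed [s], so that [lqset K s] does not change. *)
elim/last_ind: p q => [|p u IHp] q es.
  have [G [rG degG rkG]] := cartan_resolution K (set0 : {set 'I_n}).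
  have rk0 i : rk G i = 0%N by rewrite -[LHS]/(arank G i.+1) rkG cards0.
  exists G; split=> [|i|i d].
  - suff -> : mon_ideal K [::] = ideal_gen [seq ext_gen K k | k <- enum (set0 : {set 'I_n})] by [].
    by rewrite /mon_ideal enum_set0.
  - by apply/matrixP=> a; have := ltn_ord a; rewrite {2}rk0.
  by rewrite big_nil big1 // => a; have := ltn_ord a; rewrite {2}rk0.
have [|P [rP minP cntP]] := IHp (u :: q); first by rewrite es cat_rcons.
have us : u \in s by rewrite es mem_cat mem_rcons mem_head.
have /existsP[T /eqP eT] := colon_s u us.
have eset : lqset K s u = T.
  by apply/setP=> k; rewrite inE eT ext_gen_var_ideal.
have T0 : (0 < #|T|)%N.
  rewrite -eset; apply: leq_trans (subset_leq_card (supp_sub_lqset s u)).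
  by rewrite card_gt0; apply: contraNneq s0 => <-.
have [Q [rQ degQ rkQ]] := cartan_resolution K T.
have colonT : colon (mon_ideal K p) (mon K u) =
    ideal_gen [seq ext_gen K k | k <- enum T].
  by rewrite -eT es prev_colon_rcons // -es.
have deg_p v : v \in p -> (#|v| <= #|u|)%N.
  move: incr_s; rewrite /degree_increasing es cat_rcons map_cat.
  rewrite (sorted_pairwise leq_trans) pairwise_cat => /and3P[/allrelP le_pu _ _] pv.
  by apply: le_pu; rewrite ?map_f ?mem_head.
have degP i a : (@gdeg _ _ P i a <= i%:Z + #|u|%:Z)%R.
  (* The bound is read off from the count: no generator before [u] contributes a degree above it. *)
  have := cntP i (fun x => i%:Z + #|u|%:Z < x); rewrite [RHS]big1_seq => [|v /andP[_ /deg_p vu]].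
    move/eqP; rewrite sum_nat_eq0 => /forallP/(_ a).
    by rewrite leNgt; case: (_ < _).
  rewrite (_ : (_ < _) = false) ?muln0 //; lia.
have [G [rG minG cntG]] := cone_resolution rP rQ degQ colonT degP minP.
exists G; split=> // i d; rewrite cntG cntP big_rcons /=; congr (_ + _)%N.
rewrite eset rkQ; case: #|T| T0 => // t _.
by rewrite subn1 addnS subn1.
Qed.

End LinearQuotients.

Theorem corollary3p3 (K : fieldType) (n : nat) (I : {vspace exterior K n})
    (s : seq {set 'I_n})
    (I_monomial : is_monomial_ideal I)
    (I_proper : I != fullv)
    (s_linquot : linear_quotients I s)
    (s_degree : degree_increasing s) :
  (forall (i : nat) (j : int),
     graded_betti I i (i%:Z + j)
       (\sum_(u in mingens I | #|u|%:Z == j)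
          'C(i + #|lqset K s u| - 1, #|lqset K s u| - 1))%N) /\
  (forall i : nat,
     total_betti I i
       (\sum_(u in mingens I)
          'C(i + #|lqset K s u| - 1, #|lqset K s u| - 1))%N).
Proof.
have /andP[s_gens s_colon] := s_linquot.
have Is : mon_ideal K s = I.
  by rewrite -(mon_ideal_mingens I_monomial); apply/mon_ideal_eq_mem/perm_mem.
(* The empty set stands for the monomial 1, which a proper ideal cannot contain. *)
have s0 : set0 \notin s.
  by apply: contraNN I_proper => /(mon_ideal_set0 K); rewrite Is => ->.
have uniq_s : uniq s by rewrite (perm_uniq s_gens) enum_uniq.
have [|G [rG minG cntG]] :=
  @linear_quotients_resolution K n s s [::] _ uniq_s s0 s_degree s_colon.
  by rewrite cats0.
rewrite Is in rG.
(* The condition on [u] becomes a 0-1 factor, the form in which [cntG] counts. *)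
have sumE (d : pred {set 'I_n}) (c : {set 'I_n} -> nat) :
    (\sum_(u in mingens I | d u) c u = \sum_(u <- s) c u * d u)%N.
  rewrite (perm_big _ s_gens) /= big_enum big_mkcondr /=.
  by apply: eq_bigr => u _; case: (d u); rewrite ?muln1 ?muln0.
split=> [i j|i]; split; try (by exists G); move=> F rF.
  rewrite (tor_dim_minimal rF rG minG) sumE (cntG i (pred1 (i%:Z + j))).
  by apply: eq_bigr => u _; rewrite /= (inj_eq (addrI _)).
rewrite (tor_total_dim_minimal rF rG minG).
have := cntG i predT; rewrite sum_nat_const card_ord muln1 => ->.
have := sumE predT; rewrite /= => <-; first by apply: eq_bigl => u; rewrite andbT.
Qed.
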